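(* Let $K$ be an l-closed and log-explicit differential field of characteristic $0$. Let $\theta$ be transcendental over $K$ with $\theta' = \eta'\theta$ for some $\eta \in K$, such that $K(\theta)$ and $K$ have the same constants. If $f = \sum_{j} a_j\theta^j$ (a finite sum, $a_j \in K$, $j\in \mathbb{Z}$) has an integral in a gamma extension of $K(\theta)$, then for each $j$ the term $a_j\theta^j$ has an integral in a gamma extension of $K(\theta)$. If $f$ has an integral in a rational gamma extension of $K(\theta)$, then each $a_j\theta^j$ has an integral in a rational gamma extension of $K(\theta)$, and the assumption that $K$ is log-explicit can be dropped.
   Context: A constant is an element with zero derivative; an irrational constant is a constant not in $\mathbb{Q}$. An element $u\neq 0$ of a differential field $L$ is an exponential element if there is $v\in L$ with $v'=u'/u$. $k$ is l-closed if for every algebraic extension $L$ of $k$: whenever $c_1,\dots,c_n\in L$ are constants linearly independent over $\mathbb{Q}$, $u_i \in L$ nonzero, $v\in L$, and $\sum c_iu_i'/u_i = v'$, then for each $i$ some positive power of $u_i$ equals a constant multiple of an element of $k$. $k$ is log-explicit if for every algebraic extension $L$ of $k$: whenever $\sum c_i u_i'/u_i = v'$ with nonzero $u_i\in L$, $v\in L$, constants $c_i \in L$ linearly independent over $\mathbb{Q}$, each $u_i$ is an exponential element of $L$. A differential field extension $G$ of $F$ is a gamma extension if $G = F(\theta_1,\dots,\theta_n)$ where, with $F_i = F(\theta_1,\dots,\theta_{i-1})$, for each $i$ one of: (1) $\theta_i$ algebraic over $F_i$; (2) $\theta_i\neq0$, $\theta_i'/\theta_i = u'$ for some $u \in F_i$;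 (3) $\theta_i' = u'/u$ for some nonzero $u \in F_i$; (4) $\theta_i' = u'/v$ for some $u, v \in F_i$, $v\ne0$, with $u' = v'u$; (5) there are $w, u, v \in F_i$ and integers $k, m$ with $\theta_i' = wu'$, $u' = v'u$, $w^k = v^m$, $-k< m < 0$; (6) there are $w, u, v \in F_i$ and an irrational constant $a$ with $\theta_i' = w'u$, $u' = ((a - 1)v' - w')u$, $v' = w'/w$. A rational gamma extension allows only (1)–(5). $f$ has an integral in such an extension $G$ if $g'=f$ for some $g\in G$. *)

(* Defs.v *)
From HB Require Import structures.
From mathcomp Require Import all_boot all_order all_algebra.

Set Implicit Arguments.
Unset Strict Implicit.
Unset Printing Implicit Defensive.

Import GRing.Theory.

Local Open Scope ring_scope.

HB.mixin Record hasDerivation K of GRing.Field K := {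
  der : K -> K;
  derD : forall x y : K, der (x + y) = der x + der y;
  derM : forall x y : K, der (x * y) = der x * y + x * der y
}.

#[short(type="diffFieldType")]
HB.structure Definition DiffField := {K of GRing.Field K & hasDerivation K}.

Definition is_constant (K : diffFieldType) (c : K) : Prop := der c = 0.

(* [ratr] is the embedding of the prime field only in characteristic 0, which
   is the only case in which these notions are used. *)
Definition irrational_constant (K : diffFieldType) (c : K) : Prop :=
  is_constant c /\ forall q : rat, c <> ratr q.

Definition Qlin_indep (K : fieldType) (n : nat) (c : 'I_n -> K) : Prop :=
  forall q : 'I_n -> rat, \sum_(i < n) ratr (q i) * c i = 0 ->
  forall i, q i = 0.

Definition exponential_element (K : diffFieldType) (u : K) : Prop :=
  u != 0 /\ exists v : K, der v = der u / u.

(* A differential field extension of K is a differential field L with a ring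
   morphism K -> L commuting with the derivations; K is identified with its
   image. *)
Definition differential (K L : diffFieldType) (iota : {rmorphism K -> L}) :
  Prop := {morph iota : x / der x}.

Definition algebraic_ext (K L : diffFieldType) (iota : {rmorphism K -> L}) :
  Prop := differential iota /\ forall x : L, algebraicOver iota x.

Definition l_closed (K : diffFieldType) : Prop :=
  forall (L : diffFieldType) (iota : {rmorphism K -> L}),
  algebraic_ext iota ->
  forall (n : nat) (c u : 'I_n -> L) (v : L),
  (forall i, is_constant (c i)) -> Qlin_indep c -> (forall i, u i != 0) ->
  \sum_(i < n) c i * (der (u i) / u i) = der v ->
  forall i, exists (r : nat) (b : L) (a : K),
    [/\ (0 < r)%N, is_constant b & u i ^+ r = b * iota a].

Definition log_explicit (K : diffFieldType) : Prop :=
  forall (L : diffFieldType) (iota : {rmorphism K -> L}),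
  algebraic_ext iota ->
  forall (n : nat) (c u : 'I_n -> L) (v : L),
  (forall i, is_constant (c i)) -> Qlin_indep c -> (forall i, u i != 0) ->
  \sum_(i < n) c i * (der (u i) / u i) = der v ->
  forall i, exponential_element (u i).

(* [adjoin iota s] is the subfield K(s) of L: the smallest subfield containing
   the image of K and the elements of s. *)
Inductive adjoin (K L : fieldType) (iota : {rmorphism K -> L}) (s : seq L) :
  L -> Prop :=
| adjoin_base a : adjoin iota s (iota a)
| adjoin_gen x of x \in s : adjoin iota s x
| adjoin_sub x y of adjoin iota s x & adjoin iota s y : adjoin iota s (x - y)
| adjoin_mul x y of adjoin iota s x & adjoin iota s y : adjoin iota s (x * y)
| adjoin_inv x of adjoin iota s x : adjoin iota s x^-1.

Definition algebraic_over (L : fieldType) (F : L -> Prop) (x : L) : Prop :=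
  exists p : {poly L}, [/\ p != 0, forall i, F p`_i & root p x].

Section Steps.

Variables (G : diffFieldType) (F : G -> Prop) (t : G).

Definition exp_step : Prop :=
  t != 0 /\ exists2 u, F u & der t / t = der u.

Definition log_step : Prop :=
  exists u, [/\ F u, u != 0 & der t = der u / u].

(* Exponential integral: u = exp v. *)
Definition expint_step : Prop :=
  exists u v, [/\ F u, F v, v != 0, der t = der u / v & der u = der v * u].

(* Incomplete gamma function with rational parameter: u = exp v and w is the
   rational power v ^ (m / k), with -1 < m / k < 0. The negative power of v
   makes sense only for v != 0. *)
Definition rational_gamma_function_step : Prop :=
  exists w u v (k m : int),
    [/\ F w, F u & F v] /\
    [/\ v != 0, der t = w * der u, der u = der v * u,
        w ^ k = v ^ m & (- k < m < 0)%R].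

(* Incomplete gamma function with irrational parameter a: v = log w and
   u = w ^ (a - 1) * exp (- w). *)
Definition irrational_gamma_function_step : Prop :=
  exists w u v a,
    [/\ F w, F u, F v & irrational_constant a] /\
    [/\ w != 0, der t = der w * u,
        der u = ((a - 1) * der v - der w) * u & der v = der w / w].

Definition rational_gamma_step : Prop :=
  [\/ algebraic_over F t, exp_step, log_step |
      expint_step \/ rational_gamma_function_step].

Definition gamma_step : Prop :=
  rational_gamma_step \/ irrational_gamma_function_step.

End Steps.

Definition tower_ext
    (step : forall G : diffFieldType, (G -> Prop) -> G -> Prop)
    (F G : diffFieldType) (iota : {rmorphism F -> G}) : Prop :=
  differential iota /\
  exists s : seq G,
    (forall i, (i < size s)%N -> step G (adjoin iota (take i s)) s`_i) /\
    (forall x : G, adjoin iota s x).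

Definition gamma_ext := tower_ext gamma_step.

Definition rational_gamma_ext := tower_ext rational_gamma_step.

Definition has_integral_in_gamma_ext (F : diffFieldType) (f : F) : Prop :=
  exists (G : diffFieldType) (iota : {rmorphism F -> G}),
    gamma_ext iota /\ exists g : G, der g = iota f.

Definition has_integral_in_rational_gamma_ext (F : diffFieldType) (f : F) :
  Prop :=
  exists (G : diffFieldType) (iota : {rmorphism F -> G}),
    rational_gamma_ext iota /\ exists g : G, der g = iota f.

(* Main.v *)
(* A gamma extension [G] of [E] carries more symmetry than the theorem asks for:
   the Euler derivation [theta d/dtheta] of [E = K(theta)], which is zero on [K]
   and commutes with [der], extends to a derivation [D] of [G] commuting with
   [der].  Along the tower it is extended one generator at a time; e.g. if
   [der t = der u / v] with [u = exp v], take [D t = D v * u / v + c * t], where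
   [c = D u / u - D v] is a constant.  Incomplete gamma functions with irrational
   parameter [a] need [D a = 0], so the parameters are adjoined first; this is
   possible because [D] kills the constants of [E].  The set of derivatives of
   elements of [G] is then stable under [D - l] for every integer [l], and
   [D - l] multiplies [a_k theta^k] by [k - l]: the terms of [f] can be killed
   one at a time, so each term has an integral in [G] itself. *)
Require Import Defs.
From HB Require Import structures.
From mathcomp Require Import all_boot all_order all_algebra.
From mathcomp Require Import ring.
From Stdlib Require Import ClassicalEpsilon.

Set Implicit Arguments.
Unset Strict Implicit.
Unset Printing Implicit Defensive.

Import GRing.Theory.

Local Open Scope ring_scope.

(** * Subfields of a fixed field, derivations on them, and simple extensions *)

Section Subfields.

Variable L : fieldType.
Implicit Types (F : L -> Prop) (D : L -> L) (p q : {poly L}) (s t x y : L).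

(** Subfields are predicates on one ambient field and derivations are total functions constrained
    only on a subfield, possibly with values outside it. Every extension of a derivation then takes
    place inside [L]. *)
Record subfield F : Prop := Subfield {
  subfield1 : F 1;
  subfieldB : forall x y, F x -> F y -> F (x - y);
  subfieldM : forall x y, F x -> F y -> F (x * y);
  subfieldV : forall x, F x -> F x^-1 }.

Record derivation_on F D : Prop := DerivationOn {
  drvD : forall x y, F x -> F y -> D (x + y) = D x + D y;
  drvM : forall x y, F x -> F y -> D (x * y) = D x * y + x * D y }.

Definition poly_over F p := forall i, F p`_i.

(* The value at [t] of the derivative of [p(t)], for the extension of [D]
   sending [t] to [s]. *)
Definition jet D s t p := (map_poly D p).[t] + p^`().[t] * s.

(** The field [F(t)] as explicit fractions, so that a derivation on it can be given by the quotient
    rule. *)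
Definition adj F t x :=
  exists p q, [/\ poly_over F p, poly_over F q, q.[t] != 0 & x = p.[t] / q.[t]].

Section Closure.

Variables (F : L -> Prop) (sF : subfield F).

Lemma subfield0 : F 0.
Proof. by rewrite -(subrr 1); apply: (subfieldB sF); apply: (subfield1 sF). Qed.

Lemma subfieldN x : F x -> F (- x).
Proof. by move=> Fx; rewrite -sub0r; apply: (subfieldB sF) => //; exact: subfield0. Qed.

Lemma subfieldD x y : F x -> F y -> F (x + y).
Proof. by move=> Fx Fy; rewrite -[y]opprK; apply: (subfieldB sF) => //; apply: subfieldN. Qed.

Lemma subfield_div x y : F x -> F y -> F (x / y).
Proof. by move=> Fx Fy; apply: (subfieldM sF) => //; apply: (subfieldV sF). Qed.

Lemma subfield_sum I (r : seq I) (P : pred I) (f : I -> L) :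
  (forall i, F (f i)) -> F (\sum_(i <- r | P i) f i).
Proof. by move=> Ff; apply: big_ind => //; [exact: subfield0 | exact: subfieldD]. Qed.

Lemma subfieldX n x : F x -> F (x ^+ n).
Proof.
move=> Fx; elim: n => [|n IHn]; first exact: (subfield1 sF).
by rewrite exprS; apply: (subfieldM sF).
Qed.

Lemma subfield_nat n : F n%:R.
Proof.
elim: n => [|n IHn]; first exact: subfield0.
by rewrite -natr1; apply: subfieldD => //; apply: (subfield1 sF).
Qed.

Lemma poly_overD p q : poly_over F p -> poly_over F q -> poly_over F (p + q).
Proof. by move=> Fp Fq i; rewrite coefD; apply: subfieldD. Qed.

Lemma poly_overN p : poly_over F p -> poly_over F (- p).
Proof. by move=> Fp i; rewrite coefN; apply: subfieldN. Qed.

Lemma poly_overB p q : poly_over F p -> poly_over F q -> poly_over F (p - q).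
Proof. by move=> Fp Fq; apply: poly_overD => //; apply: poly_overN. Qed.

Lemma poly_overM p q : poly_over F p -> poly_over F q -> poly_over F (p * q).
Proof. by move=> Fp Fq i; rewrite coefM; apply: subfield_sum => j; apply: (subfieldM sF). Qed.

Lemma poly_overC x : F x -> poly_over F x%:P.
Proof. by move=> Fx i; rewrite coefC; case: eqP => // _; apply: subfield0. Qed.

Lemma poly_overXn n : poly_over F 'X^n.
Proof. by move=> i; rewrite coefXn; apply: subfield_nat. Qed.

Lemma poly_overX : poly_over F 'X.
Proof. by rewrite -['X]expr1; apply: poly_overXn. Qed.

Lemma poly_over_deriv p : poly_over F p -> poly_over F p^`().
Proof.
move=> Fp i; rewrite coef_deriv -mulr_natr; apply: (subfieldM sF) => //.
exact: subfield_nat.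
Qed.

Lemma poly_over_map D p : D 0 = 0 -> (forall x, F x -> F (D x)) ->
  poly_over F p -> poly_over F (map_poly D p).
Proof. by move=> D0 FD Fp i; rewrite coef_map_id0 //; apply: FD. Qed.

Lemma subfield_horner p x : poly_over F p -> F x -> F p.[x].
Proof.
move=> Fp Fx; rewrite horner_coef; apply: subfield_sum => i.
by apply: (subfieldM sF) => //; apply: subfieldX.
Qed.

Lemma poly_over_consP p x : poly_over F (p * 'X + x%:P) -> poly_over F p /\ F x.
Proof.
move=> Fpx; split=> [i|]; last by have := Fpx 0; rewrite coefD coefMX coefC add0r.
by have := Fpx i.+1; rewrite coefD coefMX coefC addr0.
Qed.

Lemma adj_base t x : F x -> adj F t x.
Proof.
move=> Fx; exists x%:P, 1%:P; rewrite !hornerC oner_eq0 divr1.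
by split=> //; apply: poly_overC => //; apply: (subfield1 sF).
Qed.

Lemma adj_gen t : adj F t t.
Proof.
exists 'X, 1%:P; rewrite hornerX hornerC oner_eq0 divr1.
by split=> //; [exact: poly_overX | apply: poly_overC; exact: (subfield1 sF)].
Qed.

Lemma adj_subfield t : subfield (adj F t).
Proof.
split=> [|x y|x y|x].
- by apply: adj_base; apply: (subfield1 sF).
- move=> [p1 [q1 [Fp1 Fq1 q1n ->]]] [p2 [q2 [Fp2 Fq2 q2n ->]]].
  exists (p1 * q2 - p2 * q1), (q1 * q2); split; rewrite ?hornerE ?mulf_neq0 //.
  + by apply: poly_overB; apply: poly_overM.
  + exact: poly_overM.
  + by field; rewrite q1n q2n.
- move=> [p1 [q1 [Fp1 Fq1 q1n ->]]] [p2 [q2 [Fp2 Fq2 q2n ->]]].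
  exists (p1 * p2), (q1 * q2).
  by split; rewrite ?hornerM ?mulf_neq0 ?mulf_div //; apply: poly_overM.
- move=> [p [q [Fp Fq qn ->]]]; have [p0|pn] := eqVneq p.[t] 0.
    by rewrite p0 mul0r invr0; apply: adj_base; apply: subfield0.
  by exists q, p; split=> //; rewrite invf_div.
Qed.

Section Derivation.

Variables (D : L -> L) (dD : derivation_on F D).

Lemma drv0 : D 0 = 0.
Proof.
apply: (@addrI _ (D 0)).
by rewrite -(drvD dD) ?addr0 //; apply: subfield0.
Qed.

Lemma drv1 : D 1 = 0.
Proof.
have F1 := subfield1 sF; apply: (@addrI _ (D 1)).
by rewrite addr0 -{3}[1]mulr1 (drvM dD) // mulr1 mul1r.
Qed.

Lemma drvN x : F x -> D (- x) = - D x.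
Proof.
move=> Fx; apply/eqP; rewrite -addr_eq0 -(drvD dD) ?addNr ?drv0 //.
exact: subfieldN.
Qed.

Lemma drvB x y : F x -> F y -> D (x - y) = D x - D y.
Proof. by move=> Fx Fy; rewrite (drvD dD) ?drvN //; apply: subfieldN. Qed.

Lemma drvV x : F x -> D x^-1 = - D x / x ^+ 2.
Proof.
move=> Fx; have [->|xn] := eqVneq x 0; first by rewrite invr0 drv0 oppr0 mul0r.
have := drvM dD Fx (subfieldV sF Fx).
rewrite mulfV // drv1 => /esym/eqP; rewrite addrC addr_eq0 => /eqP e.
apply: (mulfI xn); by rewrite e; field.
Qed.

Lemma drv_div x y : F x -> F y -> y != 0 ->
  D (x / y) = (D x * y - x * D y) / y ^+ 2.
Proof.
move=> Fx Fy yn; rewrite (drvM dD) ?drvV //; last exact: (subfieldV sF).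
by field.
Qed.

Lemma drv_sum I (r : seq I) (P : pred I) (f : I -> L) : (forall i, F (f i)) ->
  D (\sum_(i <- r | P i) f i) = \sum_(i <- r | P i) D (f i).
Proof.
move=> Ff; elim: r => [|i r IHr]; first by rewrite !big_nil drv0.
rewrite !big_cons; case: (P i) => //.
by rewrite (drvD dD) ?IHr //; apply: subfield_sum.
Qed.

Lemma drv_exp n x : F x -> x != 0 -> D (x ^+ n) = n%:R * x ^+ n * (D x / x).
Proof.
move=> Fx xn; elim: n => [|n IHn]; first by rewrite drv1 !mul0r.
rewrite exprS (drvM dD) //; last exact: subfieldX.
by rewrite IHn -natr1; field.
Qed.

Lemma drv_expz (n : int) x : F x -> x != 0 ->
  D (x ^ n) = n%:~R * x ^ n * (D x / x).
Proof.
move=> Fx xn; case: n => n; first exact: drv_exp.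
have -> : x ^ Negz n = (x ^+ n.+1)^-1 by [].
have -> : (Negz n)%:~R = - n.+1%:R :> L by rewrite NegzE mulrNz.
rewrite drvV ?drv_exp //; last exact: subfieldX.
by field; rewrite xn expf_neq0.
Qed.

Lemma jetD s t p q : poly_over F p -> poly_over F q ->
  jet D s t (p + q) = jet D s t p + jet D s t q.
Proof.
move=> Fp Fq; have -> : jet D s t (p + q) =
    (map_poly D p + map_poly D q).[t] + (p + q)^`().[t] * s.
  congr (_.[_] + _); apply/polyP=> i.
  by rewrite !coefD !coef_map_id0 ?drv0 // coefD (drvD dD).
by rewrite derivD !hornerD /jet; ring.
Qed.

Lemma jetB s t p q : poly_over F p -> poly_over F q ->
  jet D s t (p - q) = jet D s t p - jet D s t q.
Proof.
move=> Fp Fq; apply: (addIr (jet D s t q)); rewrite subrK -jetD ?subrK //.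
exact: poly_overB.
Qed.

Lemma jetM s t p q : poly_over F p -> poly_over F q ->
  jet D s t (p * q) = jet D s t p * q.[t] + p.[t] * jet D s t q.
Proof.
move=> Fp Fq; have -> : jet D s t (p * q) =
    (map_poly D p * q + p * map_poly D q).[t] + (p * q)^`().[t] * s.
  congr (_.[_] + _); apply/polyP=> i.
  rewrite coefD !coef_map_id0 ?drv0 // !coefM drv_sum; last first.
    by move=> j; apply: (subfieldM sF).
  rewrite -big_split /=; apply: eq_bigr => j _.
  by rewrite !coef_map_id0 ?drv0 // (drvM dD).
by rewrite derivM !(hornerD, hornerM) /jet; ring.
Qed.

Lemma jetC s t x : jet D s t x%:P = D x.
Proof.
rewrite /jet derivC horner0 mul0r addr0.
have -> : map_poly D x%:P = (D x)%:P.
  by apply/polyP=> i; rewrite coef_map_id0 ?drv0 // !coefC; case: eqP; rewrite ?drv0.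
exact: hornerC.
Qed.

Lemma jetX s t : jet D s t 'X = s.
Proof.
have -> : jet D s t 'X = (0 : {poly L}).[t] + ('X)^`().[t] * s.
  congr (_.[_] + _); apply/polyP=> i; rewrite coef_map_id0 ?drv0 // coefX coef0.
  by case: (i == 1%N); rewrite ?drv1 ?drv0.
by rewrite derivX horner0 hornerC add0r mul1r.
Qed.

Lemma drv_horner p t : poly_over F p -> F t -> D p.[t] = jet D (D t) t p.
Proof.
move=> + Ft; elim/poly_ind: p => [|p x IHp].
  by rewrite -[0 in X in _ -> X]polyC0 jetC hornerC.
move=> /poly_over_consP[Fp Fx]; rewrite jetD ?jetM ?jetC ?jetX //; last first.
- exact: poly_overC.
- by apply: poly_overM => //; apply: poly_overX.
- exact: poly_overX.
rewrite hornerMXaddC hornerX (drvD dD) ?(drvM dD) ?IHp //.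
- exact: subfield_horner.
- by apply: subfieldM => //; exact: subfield_horner.
Qed.

(** The value [s] at [t] is consistent once every polynomial relation of [t] over [F] survives
    formal differentiation; the quotient rule does the rest. *)
Lemma extend_derivation t s :
  (forall p, poly_over F p -> p.[t] = 0 -> jet D s t p = 0) ->
  exists D', [/\ derivation_on (adj F t) D', forall x, F x -> D' x = D x & D' t = s].
Proof.
move=> jet0; pose J p := jet D s t p.
pose R x y := exists p q, [/\ poly_over F p, poly_over F q, q.[t] != 0,
  x = p.[t] / q.[t] & y = (J p * q.[t] - p.[t] * J q) / q.[t] ^+ 2].
pose D' x := epsilon (inhabits 0) (R x).
have D'E p q : poly_over F p -> poly_over F q -> q.[t] != 0 ->
    D' (p.[t] / q.[t]) = (J p * q.[t] - p.[t] * J q) / q.[t] ^+ 2.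
  move=> Fp Fq qn; set x := p.[t] / q.[t].
  have : R x (D' x).
    by apply: epsilon_spec; exists ((J p * q.[t] - p.[t] * J q) / q.[t] ^+ 2), p, q.
  case=> p2 [q2 [Fp2 Fq2 q2n xE ->]].
  have pE : p.[t] = x * q.[t] by rewrite /x; field.
  have p2E : p2.[t] = x * q2.[t] by rewrite xE; field.
  have Fpq := poly_overM Fp Fq2; have Fp2q := poly_overM Fp2 Fq.
  (* This polynomial vanishes at [t], hence so does its jet, and the quotient-rule values of two
     representations of [x] agree. *)
  have : J (p * q2 - p2 * q) = 0.
    apply: jet0; first exact: poly_overB.
    by rewrite !hornerE pE p2E; ring.
  rewrite /J jetB // !jetM // pE p2E => e.
  apply: (mulIf (mulf_neq0 qn q2n)); apply/eqP; rewrite -subr_eq0; apply/eqP.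
  by rewrite -[RHS]oppr0 -e; field; rewrite qn q2n.
exists D'; split.
- split=> x y.
  + move=> [p1 [q1 [Fp1 Fq1 q1n ->]]] [p2 [q2 [Fp2 Fq2 q2n ->]]].
    have F1 := poly_overM Fp1 Fq2; have F2 := poly_overM Fp2 Fq1.
    have -> : p1.[t] / q1.[t] + p2.[t] / q2.[t] = (p1 * q2 + p2 * q1).[t] / (q1 * q2).[t].
      by rewrite !hornerE; field; rewrite q1n q2n.
    rewrite !D'E ?hornerM ?mulf_neq0 //; last 2 first.
    * exact: poly_overD.
    * exact: poly_overM.
    by rewrite /J jetD // !jetM // !(hornerD, hornerM); field; rewrite q1n q2n.
  + move=> [p1 [q1 [Fp1 Fq1 q1n ->]]] [p2 [q2 [Fp2 Fq2 q2n ->]]].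
    have -> : p1.[t] / q1.[t] * (p2.[t] / q2.[t]) = (p1 * p2).[t] / (q1 * q2).[t].
      by rewrite !hornerM mulf_div.
    rewrite !D'E ?hornerM ?mulf_neq0 //; try exact: poly_overM.
    by rewrite /J !jetM //; field; rewrite q1n q2n.
- move=> x Fx; have F1 := subfield1 sF.
  have := D'E _ _ (poly_overC Fx) (poly_overC F1).
  rewrite !hornerC divr1 oner_eq0 => -> //.
  by rewrite /J !jetC drv1 expr1n mulr0 subr0 mulr1 divr1.
- have F1 := subfield1 sF; have := D'E _ _ poly_overX (poly_overC F1).
  rewrite hornerX hornerC divr1 oner_eq0 => -> //.
  by rewrite /J jetX jetC drv1 expr1n mulr0 subr0 mulr1 divr1.
Qed.

End Derivation.

(** Serves as an induction principle on [F(t)], with [F'] a property stable under the field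
    operations. *)
Lemma adj_min (F' : L -> Prop) t : subfield F' -> (forall x, F x -> F' x) -> F' t ->
  forall x, adj F t x -> F' x.
Proof.
move=> sF' sub F't _ [p [q [Fp Fq _ ->]]].
have F'horner r : poly_over F r -> F' r.[t].
  move=> Fr; rewrite horner_coef; elim/big_ind: _ => // [|x y|i _].
  - by rewrite -(subrr 1); apply: (subfieldB sF'); exact: (subfield1 sF').
  - move=> F'x F'y; rewrite -[y]opprK -[- y]sub0r -[0](subrr y).
    by do ![apply: (subfieldB sF') => //].
  - apply: (subfieldM sF'); first exact/sub/Fr.
    elim: (i : nat) => [|n IHn]; first exact: (subfield1 sF').
    by rewrite exprS; apply: (subfieldM sF').
by apply: (subfieldM sF'); [exact: F'horner | apply: (subfieldV sF'); exact: F'horner].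
Qed.

Lemma poly_over_monic p : poly_over F p -> p != 0 -> exists l p1,
  [/\ F l, poly_over F p1, p1 \is monic, size p1 = size p & p = l%:P * p1].
Proof.
move=> Fp pn; have ln : lead_coef p != 0 by rewrite lead_coef_eq0.
have Fl : F (lead_coef p) by apply: Fp.
exists (lead_coef p), ((lead_coef p)^-1%:P * p); split=> //.
- apply: poly_overM => //; apply: poly_overC; exact: (subfieldV sF).
- by rewrite monicE lead_coefM lead_coefC mulVf.
- by rewrite size_Cmul // invr_eq0.
- by rewrite mulrA -polyCM mulfV // mul1r.
Qed.

(** One step of Euclidean division; the descents on size below use nothing more. *)
Lemma poly_over_reduce m q : poly_over F m -> poly_over F q -> m != 0 ->
  (size m <= size q)%N ->
  exists2 h, poly_over F h & (size (q - h * m)%R < size q)%N.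
Proof.
move=> Fm Fq mn le_mq; have sm : (0 < size m)%N by rewrite size_poly_gt0.
have sq := leq_trans sm le_mq; pose k := (size q - size m)%N.
exists ((lead_coef q / lead_coef m)%:P * 'X^k).
  apply: poly_overM; last exact: poly_overXn.
  by apply: poly_overC; apply: subfield_div; [exact: Fq | exact: Fm].
(* At index [(size q).-1] the leading terms cancel; beyond it both coefficients are zero by
   default. *)
rewrite -(prednK sq) ltnS; apply/leq_sizeP => j lej.
rewrite -mulrA coefB coefCM coefXnM.
have jk : (j < k)%N = false.
  by apply/negbTE; rewrite -leqNgt (leq_trans _ lej) // /k -subn1 leq_sub2l.
rewrite jk; move: lej; rewrite leq_eqVlt => /predU1P[<-|ltj].
  have -> : ((size q).-1 - k = (size m).-1)%N.
    by rewrite /k -!subn1 subnAC subKn.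
  by rewrite -!lead_coefE mulfVK ?subrr // lead_coef_eq0.
rewrite (prednK sq) in ltj; rewrite !nth_default ?mulr0 ?subrr //.
by rewrite leq_subRL /k ?subnK // (leq_trans (leq_subr _ _)).
Qed.

End Closure.
End Subfields.

(** [P] need not be decidable, so the least size is found by strong induction and excluded
    middle. *)
Lemma min_size_poly (L : fieldType) (P : {poly L} -> Prop) :
  (exists p, P p) -> exists2 m, P m & forall q, P q -> (size m <= size q)%N.
Proof.
case=> p; have [n] := ubnP (size p); elim: n p => // n IHn p ltpn Pp.
have [[q Pq ltqp]|min] := classic (exists2 q, P q & (size q < size p)%N).
  by apply: IHn Pq; exact: leq_trans ltqp _.
exists p => // q Pq; rewrite leqNgt; apply/negP => ltqp; apply: min.
by exists q.
Qed.

(** * Extending a derivation that commutes with [der] by one generator *)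

Section CommutingDerivations.

Variable G : diffFieldType.
Hypothesis char0 : forall n, n.+1%:R != 0 :> G.
Implicit Types (F : G -> Prop) (D : G -> G) (s t u v w x y : G).

(** Closure under [der] keeps [D (der x)] inside the domain where [D] is constrained. *)
Record commuting F D : Prop := Commuting {
  comm_subfield : subfield F;
  comm_derivation : derivation_on F D;
  comm_closed_der : forall x, F x -> F (der x);
  comm_closed : forall x, F x -> F (D x);
  comm_der : forall x, F x -> D (der x) = der (D x) }.

(** Without this, relations between a new constant [a] and [F] could contradict [D a = 0]. *)
Definition kills_constants F D := forall c, F c -> is_constant c -> D c = 0.

Lemma der_derivation F : derivation_on F (@der G).
Proof. by split=> x y _ _; [exact: derD | exact: derM]. Qed.

Lemma subfieldT : subfield (fun _ : G => True).
Proof. by []. Qed.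

Lemma intr_neq0 (n : int) : n != 0 -> n%:~R != 0 :> G.
Proof. by case: n => [[|n]|n] // _; rewrite ?NegzE ?mulrNz ?oppr_eq0 char0. Qed.

Definition commutator D x := D (der x) - der (D x).

Lemma commutator_derivation F D : subfield F -> derivation_on F D ->
  (forall x, F x -> F (der x)) -> (forall x, F x -> F (D x)) ->
  derivation_on F (commutator D).
Proof.
move=> sF dD clder clD; split=> x y Fx Fy; rewrite /commutator.
  by rewrite derD !(drvD dD) ?derD; [ring | auto..].
have Fx' := clder _ Fx; have Fy' := clder _ Fy.
rewrite derM (drvM dD Fx Fy) derD (drvD dD); try exact: (subfieldM sF).
by rewrite !(drvM dD) // !derM; ring.
Qed.

Section Extension.

Variables (F : G -> Prop) (D : G -> G) (cFD : commuting F D) (t : G).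

Let sF : subfield F := comm_subfield cFD.
Let dD : derivation_on F D := comm_derivation cFD.
Let sFt : subfield (adj F t) := adj_subfield sF t.
Let dder := der_derivation F.

Definition extends_to :=
  exists2 D', commuting (adj F t) D' & forall x, F x -> D' x = D x.

Lemma adj_closed D' : derivation_on (adj F t) D' ->
  (forall x, F x -> adj F t (D' x)) -> adj F t (D' t) ->
  forall x, adj F t x -> adj F t (D' x).
Proof.
move=> dD' clF clt x Fx.
suff [] : adj F t x /\ adj F t (D' x) by [].
move: x Fx; apply: adj_min => // [|x Fx|]; last 2 first.
- by split; [exact: adj_base | exact: clF].
- by split=> //; exact: adj_gen.
split=> [|x y [Fx Fx'] [Fy Fy']|x y [Fx Fx'] [Fy Fy']|x [Fx Fx']].
- by rewrite (drv1 sFt dD'); split; [exact: (subfield1 sFt)|exact: (subfield0 sFt)].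
- by rewrite (drvB sFt dD') //; split; exact: (subfieldB sFt).
- rewrite (drvM dD') //; split; first exact: (subfieldM sFt).
  by apply: (subfieldD sFt); exact: (subfieldM sFt).
- rewrite (drvV sFt dD') //; split; first exact: (subfieldV sFt).
  apply: (subfield_div sFt); first exact: (subfieldN sFt).
  exact: (subfieldX sFt).
Qed.

Lemma adj_derivation_eq0 E : derivation_on (adj F t) E ->
  (forall x, F x -> E x = 0) -> E t = 0 -> forall x, adj F t x -> E x = 0.
Proof.
move=> dE E0 Et x Fx.
suff [] : adj F t x /\ E x = 0 by [].
move: x Fx; apply: adj_min => // [|x Fx|]; last 2 first.
- by split; [exact: adj_base | exact: E0].
- by split=> //; exact: adj_gen.
split=> [|x y [Fx Ex] [Fy Ey]|x y [Fx Ex] [Fy Ey]|x [Fx Ex]].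
- by rewrite (drv1 sFt dE); split=> //; exact: (subfield1 sFt).
- by rewrite (drvB sFt dE) // Ex Ey subrr; split=> //; exact: (subfieldB sFt).
- rewrite (drvM dE) // Ex Ey mul0r mulr0 addr0; split=> //; exact: (subfieldM sFt).
- by rewrite (drvV sFt dE) // Ex oppr0 mul0r; split=> //; exact: (subfieldV sFt).
Qed.

(** The commutator of the extension with [der] is a derivation vanishing on [F], so commutation has
    to be checked at [t] only. The last hypothesis is handed the extension and this property of its
    commutator because the algebraic case argues from them. *)
Lemma extend_commuting s :
  (forall p, poly_over F p -> p.[t] = 0 -> jet D s t p = 0) ->
  adj F t s -> adj F t (der t) ->
  (forall D', derivation_on (adj F t) D' -> (forall x, F x -> D' x = D x) ->
     D' t = s -> derivation_on (adj F t) (commutator D') -> D' (der t) = der s) ->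
  exists D', [/\ commuting (adj F t) D', forall x, F x -> D' x = D x & D' t = s].
Proof.
move=> jet0 Fs Fder comm_t.
have [D' [dD' D'E D't]] := extend_derivation sF dD jet0.
have cl_der := adj_closed (der_derivation _)
  (fun x Fx => adj_base sF t (comm_closed_der cFD Fx)) Fder.
have cl_D' : forall x, adj F t x -> adj F t (D' x).
  apply: adj_closed => // [x Fx|]; last by rewrite D't.
  by rewrite D'E //; apply: adj_base => //; exact: (comm_closed cFD).
have dC := commutator_derivation sFt dD' cl_der cl_D'.
exists D'; split=> //; split=> // x Fx; apply/eqP; rewrite -subr_eq0; apply/eqP.
apply: (adj_derivation_eq0 dC) Fx => [y Fy|].
  rewrite /commutator !D'E ?(comm_der cFD) ?subrr //.
  exact: (comm_closed_der cFD).
by rewrite /commutator comm_t // D't subrr.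
Qed.

Section Transcendental.

Hypothesis trans_t : ~ algebraic_over F t.

Lemma transcendental_jet s p : poly_over F p -> p.[t] = 0 -> jet D s t p = 0.
Proof.
move=> Fp pt; have [->|pn] := eqVneq p 0.
  by rewrite -polyC0 (jetC sF dD) (drv0 sF dD).
by case: trans_t; exists p; split=> //; apply/eqP.
Qed.

(** A transcendental [t] leaves [D t] free: any solution [s] of the equation imposed by commutation
    will do. *)
Lemma extend_primitive s : F (der t) -> adj F t s -> der s = D (der t) ->
  extends_to.
Proof.
move=> Ft' Fs s'; have [|D' _ D'E _ _|D' [cD' D'E _]] := extend_commuting (transcendental_jet s) Fs.
- exact: adj_base.
- by rewrite D'E.
by exists D'.
Qed.

Lemma extend_exponential x y : F x -> F y -> der t = x * t -> der y = D x ->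
  exists D', [/\ commuting (adj F t) D', forall z, F z -> D' z = D z & D' t = y * t].
Proof.
move=> Fx Fy t' y'; have Ft := adj_gen sF t.
have Fx1 := adj_base sF t Fx; have Fy1 := adj_base sF t Fy.
apply: extend_commuting.
- exact: transcendental_jet.
- exact: (subfieldM sFt).
- by rewrite t'; exact: (subfieldM sFt).
move=> D' dD' D'E D't _; rewrite t' (drvM dD') // D'E // D't derM t' y'.
by ring.
Qed.

End Transcendental.

(** The value at [t] is forced by differentiating the minimal relation [m] of [t], whose formal
    derivative is nonzero at [t] in characteristic 0. For the same reason the commutator, a
    derivation vanishing on [F], vanishes at [t]. *)
Lemma extend_algebraic : algebraic_over F t -> extends_to.
Proof.
move=> alg; pose P p := [/\ p != 0, poly_over F p & p.[t] = 0].
have [|m [mn Fm mt] minm] := @min_size_poly _ P.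
  by case: alg => p [pn Fp /eqP pt]; exists p.
have sm : (1 < size m)%N.
  rewrite ltnNge; apply/negP => /size1_polyC mC; move: mt mn.
  by rewrite mC hornerC => ->; rewrite polyC0 eqxx.
have m'n : m^`().[t] != 0.
  apply/eqP => m't; have : P m^`().
    split=> //; last exact: poly_over_deriv.
    (* The coefficient there is the leading coefficient of [m] times its degree, which is
       positive. *)
    apply/eqP => /polyP/(_ (size m).-2)/eqP.
    rewrite coef_deriv coef0 -mulr_natr mulf_eq0 (negPf (char0 _)) orbF.
    by rewrite -subn2 -subSn // subSS subn1 -lead_coefE lead_coef_eq0 (negPf mn).
  by move=> /minm; rewrite leqNgt lt_size_deriv.
have Fder E : (forall x, F x -> F (E x)) -> E 0 = 0 ->
    adj F t (- (map_poly E m).[t] / m^`().[t]).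
  move=> FE E0; apply: (subfield_div sFt).
    apply: (subfieldN sFt); apply: (subfield_horner sFt); last exact: adj_gen.
    by move=> i; apply: adj_base => //; apply: poly_over_map.
  apply: (subfield_horner sFt); last exact: adj_gen.
  by move=> i; apply: adj_base => //; apply: (poly_over_deriv sF).
have der_alg E : derivation_on (adj F t) E -> E t = - (map_poly E m).[t] / m^`().[t].
  move=> dE; have : E m.[t] = 0 by rewrite mt (drv0 sFt dE).
  rewrite (drv_horner sFt dE) //; last exact: adj_gen.
    by rewrite /jet => /eqP; rewrite addrC addr_eq0 => /eqP <-; field.
  by move=> i; apply: adj_base.
(* Every relation reduces to zero by multiples of [m], and the chosen value makes the jet of [m]
   vanish. *)
have jet0 p : poly_over F p -> p.[t] = 0 ->
    jet D (- (map_poly D m).[t] / m^`().[t]) t p = 0.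
  have [n] := ubnP (size p); elim: n p => // n IHn p ltpn Fp pt.
  have [->|pn] := eqVneq p 0; first by rewrite -polyC0 (jetC sF dD) (drv0 sF dD).
  have [//|h Fh lth] := poly_over_reduce sF Fm Fp mn; first exact: minm.
  have Fhm := poly_overM sF Fh Fm.
  rewrite -(subrK (h * m) p) (jetD sF dD) //; last exact: poly_overB.
  rewrite (jetM sF dD) // mt IHn //.
  - by rewrite /jet; field.
  - exact: leq_trans lth _.
  - exact: poly_overB.
  - by rewrite hornerD hornerN hornerM mt pt mulr0 subrr.
have [||D' dD' D'E D't dC|D' [cD' D'E _]] := extend_commuting jet0.
- by apply: Fder; [exact: (comm_closed cFD) | exact: (drv0 sF dD)].
- rewrite (der_alg _ (der_derivation _)).
  by apply: Fder; [exact: (comm_closed_der cFD) | exact: (drv0 sF dder)].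
- have := drv_horner sFt dC (fun i => adj_base sF t (Fm i)) (adj_gen sF t).
  rewrite mt (drv0 sFt dC) /jet.
  have -> : map_poly (commutator D') m = 0.
    apply/polyP=> i; rewrite coef_map_id0 ?(drv0 sFt dC) // coef0.
    rewrite /commutator !D'E ?(comm_der cFD) ?subrr //.
    exact: (comm_closed_der cFD).
  rewrite horner0 add0r => /esym/eqP; rewrite mulf_eq0 (negPf m'n) /=.
  by rewrite subr_eq0 D't => /eqP.
by exists D'.
Qed.

End Extension.
End CommutingDerivations.

(** * Adjoining constants, then the generators of gamma extensions *)

Section Steps.

Variable G : diffFieldType.
Hypothesis char0 : forall n, n.+1%:R != 0 :> G.
Implicit Types (F : G -> Prop) (D : G -> G) (a c s t u v w x y : G).

(** The value 0 at [a] is consistent: applying [der] to the coefficients of a monic relation of [a]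
    gives a relation of smaller size, as [a] is constant. Either this is zero, and [D] kills the
    constant coefficients of the original, or it reduces the original to a smaller relation. *)
Lemma extend_constant F D a : commuting F D -> kills_constants F D ->
  is_constant a ->
  exists D', [/\ commuting (adj F a) D', forall x, F x -> D' x = D x &
                 kills_constants (adj F a) D'].
Proof.
move=> cFD kD a0; have sF := comm_subfield cFD.
have dD := comm_derivation cFD; have dder := der_derivation F.
have sFa := adj_subfield sF a; have der0 := drv0 sF dder.
pose dp : {poly G} -> {poly G} := map_poly (@der G).
have Fdp p : poly_over F p -> poly_over F (dp p).
  by apply: poly_over_map => //; exact: (comm_closed_der cFD).
have size_dp p : (size (dp p) <= size p)%N.
  by apply/leq_sizeP => j lej; rewrite coef_map_id0 // nth_default.
have size_dp_monic p : p \is monic -> (size (dp p) < size p)%N.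
  move=> pm; have sp : (0 < size p)%N by rewrite size_poly_gt0 monic_neq0.
  rewrite -(prednK sp) ltnS; apply/leq_sizeP => j; rewrite leq_eqVlt => /predU1P[<-|ltj].
    by rewrite coef_map_id0 // -lead_coefE (monicP pm) (drv1 sF dder).
  by rewrite (prednK sp) in ltj; rewrite coef_map_id0 // nth_default.
have dp0 p : poly_over F p -> dp p = 0 -> map_poly D p = 0.
  move=> Fp p0; apply/polyP=> i; rewrite coef_map_id0 ?(drv0 sF dD) // coef0.
  apply: kD; first exact: Fp.
  by have := congr1 (fun q : {poly G} => q`_i) p0; rewrite coef_map_id0 // coef0.
have der_horner p : poly_over F p -> der p.[a] = (dp p).[a].
  move=> Fp; rewrite (drv_horner sFa (der_derivation _)) //; last exact: adj_gen.
    by rewrite /jet a0 mulr0 addr0.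
  by move=> i; exact: adj_base.
have jet0 p : poly_over F p -> p.[a] = 0 -> jet D 0 a p = 0.
  have [n] := ubnP (size p); elim: n p => // n IHn p ltpn Fp pa.
  have [->|pn] := eqVneq p 0; first by rewrite -polyC0 (jetC sF dD) (drv0 sF dD).
  have [l [p1 [Fl Fp1 mp1 sp1 pE]]] := poly_over_monic sF Fp pn.
  have p1a : p1.[a] = 0.
    move: pa pn; rewrite pE hornerM hornerC mulf_eq0 polyC_eq0 => /eqP.
    by rewrite mulf_eq0 => /orP[/eqP->|/eqP //]; rewrite eqxx.
  suff jp1 : jet D 0 a p1 = 0.
    rewrite pE (jetM sF dD) ?jp1 ?p1a ?mulr0 ?addr0 //.
    exact: poly_overC.
  have [r0|rn] := eqVneq (dp p1) 0.
    by rewrite /jet dp0 // horner0 mulr0 addr0.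
  have ra : (dp p1).[a] = 0 by rewrite -der_horner // p1a der0.
  have ltr : (size (dp p1) < n)%N.
    by apply: leq_trans (size_dp_monic _ mp1) _; rewrite sp1.
  have [|h Fh lth] := poly_over_reduce sF (Fdp _ Fp1) Fp1 rn; first exact: size_dp.
  have Fhr := poly_overM sF Fh (Fdp _ Fp1).
  rewrite -(subrK (h * dp p1) p1) (jetD sF dD) //; last exact: poly_overB.
  rewrite IHn ?add0r.
  - have jr : jet D 0 a (dp p1) = 0 by apply: IHn => //; exact: Fdp.
    by rewrite (jetM sF dD) ?jr ?ra ?mulr0 ?addr0 ?mul0r //; exact: Fdp.
  - by apply: leq_trans lth _; rewrite sp1.
  - exact: poly_overB.
  - by rewrite hornerD hornerN hornerM p1a ra mulr0 subrr.
have Fa0 : adj F a 0 by apply: (subfield0 sFa).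
have [||D' [cD' D'E D'a]] := extend_commuting cFD jet0 Fa0.
- by rewrite a0.
- by move=> D' dD' _ D'a _; rewrite a0 der0 (drv0 sFa dD').
exists D'; split=> // x Fx x0.
(* Constants of [F(a)] are quotients in [a] with constant coefficients: take a
   denominator, then a numerator, of least degree, and differentiate. *)
pose Q q := [/\ poly_over F q, q.[a] != 0 &
                exists2 p, poly_over F p & x * q.[a] = p.[a]].
have [|q0 [Fq0 q0a [p0 Fp0 xq0]] minq0] := @min_size_poly _ Q.
  by case: Fx => p [q [Fp Fq qa xE]]; exists q; split=> //; exists p; rewrite // xE divfK.
have q0n : q0 != 0 by apply: contraNneq q0a => ->; rewrite horner0.
have [l [q [Fl Fq mq sq qE]]] := poly_over_monic sF Fq0 q0n.
have [ln qa] : l != 0 /\ q.[a] != 0.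
  by apply/andP; rewrite -negb_or -mulf_eq0 -hornerCM mul_polyC -mul_polyC -qE.
have minq q' : Q q' -> (size q <= size q')%N by rewrite sq; exact: minq0.
pose P p := poly_over F p /\ x * q.[a] = p.[a].
have [|p [Fp xq] minp] := @min_size_poly _ P.
  exists (l^-1%:P * p0); split.
    by apply: poly_overM => //; apply: poly_overC => //; exact: (subfieldV sF).
  rewrite hornerCM -xq0 qE hornerCM; field; exact: ln.
(* Differentiating [x * q(a) = p(a)] with [x] and [a] constant. As [q] is monic, [dp q] is smaller,
   so by minimality it cannot be a denominator for [x] and must vanish at [a]. *)
have xdq : x * (dp q).[a] = (dp p).[a].
  by rewrite -!der_horner // -xq derM x0 mul0r add0r.
have dqa : (dp q).[a] = 0.
  apply/eqP/negPn/negP => dqa; have : Q (dp q).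
    by split=> //; [exact: Fdp | exists (dp p) => //; exact: Fdp].
  by move=> /minq; rewrite leqNgt size_dp_monic.
(* Subtracting a multiple of [dp q] keeps the value of [q] at [a]; were [dp q] nonzero, this would
   lower the size of [q]. *)
have dq0 : dp q = 0.
  apply/eqP/negPn/negP => dqn.
  have [|h Fh lth] := poly_over_reduce sF (Fdp _ Fq) Fq dqn; first exact: size_dp.
  have qh : (q - h * dp q).[a] = q.[a] by rewrite hornerD hornerN hornerM dqa mulr0 subr0.
  move: lth; rewrite ltnNge => /negP; apply; apply: minq; split; rewrite ?qh //.
    by apply: poly_overB => //; apply: poly_overM => //; exact: Fdp.
  by exists p.
have dpa : (dp p).[a] = 0 by rewrite -xdq dqa mulr0.
have dp_p0 : dp p = 0.
  apply/eqP/negPn/negP => dpn.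
  have [|h Fh lth] := poly_over_reduce sF (Fdp _ Fp) Fp dpn; first exact: size_dp.
  have ph : (p - h * dp p).[a] = p.[a] by rewrite hornerD hornerN hornerM dpa mulr0 subr0.
  move: lth; rewrite ltnNge => /negP; apply; apply: minp; split; rewrite ?ph //.
  by apply: poly_overB => //; apply: poly_overM => //; exact: Fdp.
have D'poly r : poly_over F r -> dp r = 0 -> D' r.[a] = 0.
  move=> Fr r0; rewrite (drv_horner sFa (comm_derivation cD')); last exact: adj_gen.
    rewrite /jet D'a mulr0 addr0.
    have -> : map_poly D' r = map_poly D r.
      have D'0 := drv0 sFa (comm_derivation cD').
      apply/polyP=> i.
      by rewrite coef_map_id0 // coef_map_id0 ?(drv0 sF dD) // D'E.
    by rewrite dp0 // horner0.
  by move=> i; exact: adj_base.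
have Faq : adj F a q.[a].
  by apply: (subfield_horner sFa); [move=> i; exact: adj_base | exact: adj_gen].
have := drvM (comm_derivation cD') Fx Faq.
rewrite xq !D'poly // mulr0 addr0 => /esym/eqP.
by rewrite mulf_eq0 (negPf qa) orbF => /eqP.
Qed.

Lemma extend_constants F D (cs : seq G) : commuting F D -> kills_constants F D ->
  (forall c, c \in cs -> is_constant c) ->
  exists F' D', [/\ commuting F' D', forall x, F x -> F' x,
    forall x, F x -> D' x = D x & forall c, c \in cs -> F' c /\ D' c = 0].
Proof.
move=> cFD kD ccs.
suff [F' [D' [cD' kD' sub D'E csF]]] : exists F' D', [/\ commuting F' D',
    kills_constants F' D', forall x, F x -> F' x, forall x, F x -> D' x = D x &
    forall c, c \in cs -> F' c].
  exists F', D'; split=> // c cs_c; split; first exact: csF.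
  by apply: kD'; [exact: csF | exact: ccs].
elim: cs ccs => [|a cs IHcs] ccs; first by exists F, D.
have [c cs_c|F1 [D1 [cD1 kD1 sub D1E csF1]]] := IHcs.
  by apply: ccs; rewrite inE cs_c orbT.
have [|D' [cD' D'E kD']] := extend_constant (a := a) cD1 kD1.
  by apply: ccs; exact: mem_head.
have sF1 := comm_subfield cD1.
exists (adj F1 a), D'; split=> // [x Fx|x Fx|c].
- by apply: adj_base => //; exact: sub.
- by rewrite D'E ?D1E //; exact: sub.
- rewrite inE => /predU1P[->|cs_c]; first exact: adj_gen.
  by apply: adj_base => //; exact: csF1.
Qed.

(** * The single steps of a gamma tower *)

Section Step.

Variables (F : G -> Prop) (D : G -> G) (t : G) (cFD : commuting F D).

Let sF := comm_subfield cFD.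
Let dD := comm_derivation cFD.
Let clder := comm_closed_der cFD.
Let clD := comm_closed cFD.
Let dder := der_derivation F.
Let commE := comm_der cFD.
Let sFt : subfield (adj F t) := adj_subfield sF t.
Let FFt x (Fx : F x) : adj F t x := adj_base sF t Fx.

(** Both sides are the mixed second logarithmic derivative of [u], which is symmetric in the two
    derivations. *)
Lemma der_dlog u : F u -> u != 0 -> der (D u / u) = D (der u / u).
Proof.
move=> Fu un; rewrite (drv_div sF dD) ?(drv_div (subfieldT G) (der_derivation _)) //; last exact: clder.
by rewrite commE //; field.
Qed.

(** Common shape of the exponential integral and both incomplete gamma functions. The ansatz
    [D t = r * u + c * t] with [c] constant turns commutation at [t] into the last equation; an
    algebraic [t] has its value forced instead. *)
Lemma extend_affine r c y u : F r -> F c -> F y -> F u -> der c = 0 ->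
  der t = y * u ->
  der r * u + r * der u + c * (y * u) = D y * u + y * D u -> extends_to F D t.
Proof.
move=> Fr Fc Fy Fu c0 t' rE.
have [alg|trans_t] := classic (algebraic_over F t).
  exact: (extend_algebraic char0 cFD).
apply: (extend_primitive cFD trans_t (s := r * u + c * t)).
- by rewrite t'; exact: (subfieldM sF).
- apply: (subfieldD sFt); first by apply: FFt; exact: (subfieldM sF).
  by apply: (subfieldM sFt); [exact: FFt | exact: adj_gen].
- by rewrite t' (drvM dD) // -rE derD !derM c0 t' mul0r add0r.
Qed.

Lemma extend_der0 : der t = 0 -> extends_to F D t.
Proof.
move=> t'; have F0 := subfield0 sF; have d0 := drv0 sF dder.
apply: (extend_affine (r := 0) (c := 0) (y := 0) (u := 0)) => //.
  by rewrite t' mul0r.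
by rewrite !(mul0r, mulr0, addr0).
Qed.

(** The equation determines [u] as an exponential of [z] only up to a constant factor, on which [D]
    may act; the constant obtained here is the [c] of [extend_affine]. *)
Lemma exp_defect u z : F u -> F z -> u != 0 -> der u = der z * u ->
  der (D u / u - D z) = 0.
Proof.
move=> Fu Fz un u'; rewrite (drvB (subfieldT G) (der_derivation _)) //.
by rewrite der_dlog // u' mulfK // commE // subrr.
Qed.

Lemma extend_rational_gamma_step : rational_gamma_step F t -> extends_to F D t.
Proof.
move=> step; have [alg|trans_t] := classic (algebraic_over F t).
  exact: (extend_algebraic char0 cFD).
case: step => [/trans_t[]|||[]].
- move=> [tn [u Fu t'E]].
  have t' : der t = der u * t by rewrite -t'E divfK.
  have [D' [cD' D'E _]] :=
    extend_exponential cFD trans_t (clder Fu) (clD Fu) t' (esym (commE Fu)).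
  by exists D'.
- move=> [u [Fu un t']].
  apply: (extend_primitive cFD trans_t (s := D u / u)).
  + by rewrite t'; apply: (subfield_div sF) => //; exact: clder.
  + by apply: FFt; apply: (subfield_div sF) => //; exact: clD.
  + by rewrite t' der_dlog.
- move=> [u [v [Fu Fv vn t' u']]].
  (* For [u = 0] the quotient [D u / u] is meaningless, but [t] is then a constant. *)
  have [u0|un] := eqVneq u 0.
    by apply: extend_der0; rewrite t' u' u0 mulr0 mul0r.
  have Fv' := clder Fv; have Dv := clD Fv; have Du := clD Fu.
  (* As a function of [v], the integral [t] has derivative [u / v]: the chain rule suggests [r], and
     [c] corrects for the constant factor in [u]. *)
  apply: (extend_affine (r := D v / v) (c := D u / u - D v) (y := der v / v) (u := u)) => //.
  + exact: (subfield_div sF).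
  + by apply: (subfieldB sF) => //; exact: (subfield_div sF).
  + exact: (subfield_div sF).
  + exact: exp_defect.
  + by rewrite t' u' mulrAC.
  + rewrite (drv_div (subfieldT G) (der_derivation _)) // (drv_div sF dD) // commE // u'.
    by field; rewrite un vn.
- move=> [w [u [v [k [m [[Fw Fu Fv] [vn t' u' wv /andP[ltk ltm]]]]]]]].
  have [u0|un] := eqVneq u 0.
    by apply: extend_der0; rewrite t' u' u0 !mulr0.
  have Fv' := clder Fv; have Dv := clD Fv; have Du := clD Fu.
  have k0 : k != 0 by apply: contraTneq (Order.POrderTheory.lt_trans ltk ltm) => ->.
  have kn := intr_neq0 char0 k0.
  have wn : w != 0.
    apply: contraTneq (expfz_neq0 m vn) => w0.
    by rewrite -wv w0 exp0rz (negPf k0) negbK.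
  have wkn := expfz_neq0 m vn.
  (* Logarithmic differentiation of [w ^ k = v ^ m], needed for [der] and for [D]. It follows that
     the two derivations act proportionally on [v] and [w]. *)
  have dlog_w E : derivation_on F E -> k%:~R * (E w / w) = m%:~R * (E v / v).
    move=> dE; apply: (mulfI wkn).
    have := congr1 E wv; rewrite !(drv_expz sF dE) // wv => e.
    by rewrite ![_ ^ _ * (_ * _)]mulrA ![_ ^ _ * _]mulrC.
  have wvE : der w * D v = D w * der v.
    apply: (mulfI kn).
    have -> : k%:~R * (der w * D v) = k%:~R * (der w / w) * (w * D v) by field.
    have -> : k%:~R * (D w * der v) = k%:~R * (D w / w) * (w * der v) by field.
    by rewrite !dlog_w //; field.
  apply: (extend_affine (r := w * D v) (c := D u / u - D v) (y := w * der v) (u := u)) => //.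
  + exact: (subfieldM sF).
  + by apply: (subfieldB sF) => //; exact: (subfield_div sF).
  + exact: (subfieldM sF).
  + exact: exp_defect.
  + by rewrite t' u' mulrA.
  + rewrite derM wvE (drvM dD) // commE // u'.
    by field.
Qed.

(** Since [D a = 0], applying [D] to the equation of [u] yields no term in [D a], and the correction
    [c] is constant. *)
Lemma extend_irrational_gamma_step w u v a : F w -> F u -> F v -> F a ->
  is_constant a -> D a = 0 -> w != 0 -> der t = der w * u ->
  der u = ((a - 1) * der v - der w) * u -> der v = der w / w ->
  extends_to F D t.
Proof.
move=> Fw Fu Fv Fa a' Da wn t' u' v'.
have [u0|un] := eqVneq u 0.
  by apply: extend_der0; rewrite t' u0 mulr0.
have Fw' := clder Fw; have Fv' := clder Fv; have Dw := clD Fw; have Du := clD Fu.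
have F1 := subfield1 sF; have Fa1 := subfieldB sF Fa F1.
have Fww := subfield_div sF Dw Fw.
have dG := der_derivation (fun _ : G => True).
have da1 : der (a - 1) = 0.
  by rewrite (drvB (subfieldT G) dG) // a' (drv1 (subfieldT G) dG) subrr.
have Da1 : D (a - 1) = 0 by rewrite (drvB sF dD) // Da (drv1 sF dD) subrr.
(* As a function of [w], the integral [t] has derivative [u], whence [r]. In [c], [D w / w] replaces
   [D v], from which it can differ by a constant because [v] is a logarithm of [w] only up to a
   constant. *)
apply: (extend_affine (r := D w) (c := D u / u - ((a - 1) * (D w / w) - D w))
  (y := der w) (u := u)) => //.
- apply: (subfieldB sF); first exact: (subfield_div sF).
  by apply: (subfieldB sF) => //; exact: (subfieldM sF).
- rewrite !(drvB (subfieldT G) dG) // [der ((a - 1) * _)]derM da1 mul0r add0r !der_dlog //.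
  rewrite u' mulfK // (drvB sF dD) //; last exact: (subfieldM sF).
  by rewrite (drvM dD) // Da1 mul0r add0r v' commE // subrr.
- by rewrite commE // u' v'; field; rewrite un wn.
Qed.

End Step.
End Steps.

(** * Extending a commuting derivation along a whole tower *)

Section Towers.

Variables (E G : diffFieldType) (j : {rmorphism E -> G}).

Lemma adjoin_subset (F : G -> Prop) (s : seq G) : subfield F ->
  (forall e, F (j e)) -> (forall x, x \in s -> F x) ->
  forall x, adjoin j s x -> F x.
Proof.
move=> sF Fj Fs x; elim=> // [y z _ Fy _ Fz|y z _ Fy _ Fz|y _ Fy].
- exact: (subfieldB sF).
- exact: (subfieldM sF).
- exact: (subfieldV sF).
Qed.

(** Parameters adjoined ahead of time make the fields carrying [D] larger than those of the tower,
    so steps have to be read over larger fields. *)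
Lemma rational_gamma_step_mono (F F' : G -> Prop) t : (forall x, F x -> F' x) ->
  rational_gamma_step F t -> rational_gamma_step F' t.
Proof.
move=> sub [[p [pn Fp pt]]|[tn [u Fu t']]|[u [Fu un t']]|[]].
- by apply: Or41; exists p; split=> // i; exact: sub.
- by apply: Or42; split=> //; exists u => //; exact: sub.
- by apply: Or43; exists u; split=> //; exact: sub.
- move=> [u [v [Fu Fv vn t' u']]]; apply: Or44; left.
  by exists u, v; split=> //; exact: sub.
- move=> [w [u [v [k [m [[Fw Fu Fv] h]]]]]]; apply: Or44; right.
  by exists w, u, v, k, m; split=> //; split; exact: sub.
Qed.

Hypothesis char0 : forall n, n.+1%:R != 0 :> G.

Lemma extend_tower (F : G -> Prop) (D : G -> G) (s : seq G) :
  commuting F D -> kills_constants F D -> (forall e, F (j e)) ->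
  (forall i, (i < size s)%N -> gamma_step (adjoin j (take i s)) s`_i) ->
  (forall x, adjoin j s x) ->
  exists2 D', commuting (fun _ => True) D' & forall x, F x -> D' x = D x.
Proof.
move=> cFD kD Fj step gen.
(* The list [cs] holds the parameters of later steps. Quantifying over it inside the induction lets
   each step pass its own parameter down to the bottom, where all are adjoined to [F]. *)
suff main k : (k <= size s)%N -> forall cs : seq G,
    (forall c, c \in cs -> is_constant c) -> exists F' D', [/\ commuting F' D',
      forall x, F x \/ x \in take k s -> F' x, forall x, F x -> D' x = D x &
      forall c, c \in cs -> F' c /\ D' c = 0].
  have [//|F' [D' [cD' sub D'E _]]] := main _ (leqnn (size s)) [::].
  have FT x : F' x.
    apply: adjoin_subset (gen x); first exact: comm_subfield cD'.
      by move=> e; apply: sub; left.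
    by move=> y ys; apply: sub; right; rewrite take_size.
  case: cD' => sF' [dD dM] clder clD comm.
  by exists D' => //; split=> //; [split=> *; [exact: dD | exact: dM] | move=> x _; exact: comm].
elim: k => [|k IHk] ltk cs ccs.
  have [F' [D' [cD' sub D'E csF]]] := extend_constants cFD kD ccs.
  exists F', D'; split=> // x []; [exact: sub | by rewrite take0].
have adjoin_take F' D' : commuting F' D' ->
    (forall x, F x \/ x \in take k s -> F' x) ->
    forall x, adjoin j (take k s) x -> F' x.
  move=> cD' sub; apply: adjoin_subset; first exact: comm_subfield cD'.
    by move=> e; apply: sub; left.
  by move=> y ys; apply: sub; right.
have conclude F1 D1 : commuting F1 D1 ->
    (forall x, F x \/ x \in take k s -> F1 x) -> (forall x, F x -> D1 x = D x) ->
    (forall c, c \in cs -> F1 c /\ D1 c = 0) -> extends_to F1 D1 s`_k ->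
    exists F' D', [/\ commuting F' D',
      forall x, F x \/ x \in take k.+1 s -> F' x, forall x, F x -> D' x = D x &
      forall c, c \in cs -> F' c /\ D' c = 0].
  move=> cD1 sub D1E csF1 [D' cD' D'E].
  have sF1 := comm_subfield cD1.
  exists (adj F1 s`_k), D'; split=> // [x|x Fx|c cs_c].
  - rewrite (take_nth 0) // mem_rcons inE => -[Fx|/predU1P[->|xs]].
    + by apply: adj_base => //; apply: sub; left.
    + exact: adj_gen.
    + by apply: adj_base => //; apply: sub; right.
  - by rewrite D'E ?D1E //; apply: sub; left.
  - have [F1c D1c] := csF1 _ cs_c.
    by rewrite D'E //; split=> //; exact: adj_base.
have [rat|[w [u [v [a [[Fw Fu Fv [a0 _]] [wn t' u' v']]]]]]] := step k ltk.
  have [F1 [D1 [cD1 sub D1E csF1]]] := IHk (ltnW ltk) cs ccs.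
  apply: (conclude _ _ cD1) => //.
  apply: (extend_rational_gamma_step char0) => //.
  exact: rational_gamma_step_mono (adjoin_take _ _ cD1 sub) rat.
(* The earlier stage is rebuilt so as to contain [a] with derivative 0. *)
have [|F1 [D1 [cD1 sub D1E csF1]]] := IHk (ltnW ltk) (a :: cs).
  by move=> c; rewrite inE => /predU1P[->|/ccs].
have [Fa D1a] := csF1 _ (mem_head a cs).
have subF1 := adjoin_take _ _ cD1 sub.
apply: (conclude _ _ cD1) => // [c cs_c|].
  by apply: csF1; rewrite inE cs_c orbT.
by apply: (extend_irrational_gamma_step char0 cD1 (w := w) (u := u) (v := v) (a := a)) => //; apply: subF1.
Qed.

End Towers.

(** * The Euler derivation of [K(theta)] and the separation of terms *)

Section ExponentialField.

Variables (K E : diffFieldType) (charK : [pchar K] =i pred0).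
Variables (iota : {rmorphism K -> E}) (diota : differential iota) (theta : E).
Hypothesis genE : forall x : E, adjoin iota [:: theta] x.
Hypothesis trans_theta : ~ algebraicOver iota theta.
Variables (eta : K) (dtheta : der theta = iota (der eta) * theta).
Hypothesis sameC :
  forall c : E, is_constant c -> exists2 b : K, is_constant b & c = iota b.
Variables (G : diffFieldType) (j : {rmorphism E -> G}) (dj : differential j).

Lemma extension_char0 n : n.+1%:R != 0 :> G.
Proof.
by rewrite -(rmorph_nat j) -(rmorph_nat iota) !fmorph_eq0 ((pcharf0P K).1 charK).
Qed.

Let base (x : G) : Prop := exists b, x = j (iota b).

Lemma base_commuting : commuting base (fun _ => 0).
Proof.
split=> [|||_ _|_ _].
- split=> [|_ _ [b ->] [c ->]|_ _ [b ->] [c ->]|_ [b ->]].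
  + by exists 1; rewrite !rmorph1.
  + by exists (b - c); rewrite !rmorphB.
  + by exists (b * c); rewrite !rmorphM.
  + by exists b^-1; rewrite !fmorphV.
- by split=> x y _ _; rewrite ?addr0 // mulr0 mul0r addr0.
- by move=> _ [b ->]; exists (der b); rewrite diota dj.
- by exists 0; rewrite !rmorph0.
- by rewrite (drv0 (subfieldT G) (der_derivation _)).
Qed.

Lemma base_transcendental : ~ algebraic_over base (j theta).
Proof.
move=> [p [pn Fp pt]]; apply: trans_theta.
pose b i := epsilon (inhabits (0 : K)) (fun b => p`_i = j (iota b)).
have bE i : p`_i = j (iota (b i)) by apply: epsilon_spec (Fp i).
pose q := \poly_(i < size p) b i.
have qE : map_poly j (map_poly iota q) = p.
  apply/polyP=> i; rewrite !coef_map coef_poly; case: ltnP => [_|le]; first exact/esym/bE.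
  by rewrite !raddf0 nth_default.
exists q.
  by apply: contraNneq pn => q0; rewrite -qE q0 !raddf0.
by rewrite -(fmorph_root j) qE.
Qed.

Lemma euler_derivation (s : seq G) :
  (forall i, (i < size s)%N -> gamma_step (adjoin j (take i s)) s`_i) ->
  (forall x, adjoin j s x) ->
  exists D : G -> G, [/\ commuting (fun _ => True) D,
    forall b, D (j (iota b)) = 0 & D (j theta) = j theta].
Proof.
move=> step gen; have b1 : base 1 by exists 1; rewrite !rmorph1.
have beta : base (j (iota (der eta))) by exists (der eta).
have d1 : der (1 : G) = 0 := drv1 (subfieldT G) (der_derivation _).
(* With [D theta = 1 * theta], compatibility asks that [der 1] equal the value of [D] at [der eta];
   both are zero. *)
have [|D0 [cD0 D0E D0t]] := extend_exponential base_commuting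
  base_transcendental beta b1 (t := j theta) _ d1.
  by rewrite -dj dtheta rmorphM.
rewrite mul1r in D0t; have sbase := comm_subfield base_commuting.
have F0j e : adj base (j theta) (j e).
  elim: (genE e) => [b|x|x y _ Fx _ Fy|x y _ Fx _ Fy|x _ Fx].
  - by apply: adj_base => //; exists b.
  - by rewrite inE => /eqP->; exact: adj_gen.
  - by rewrite rmorphB; apply: (subfieldB (comm_subfield cD0)).
  - by rewrite rmorphM; apply: (subfieldM (comm_subfield cD0)).
  - by rewrite fmorphV; apply: (subfieldV (comm_subfield cD0)).
have imE x : adj base (j theta) x -> exists e, x = j e.
  move: x; apply: (adj_min (F' := fun x => exists e, x = j e)) => [|_ [b ->]|].
  - split=> [|_ _ [b ->] [c ->]|_ _ [b ->] [c ->]|_ [b ->]].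
    + by exists 1; rewrite !rmorph1.
    + by exists (b - c); rewrite !rmorphB.
    + by exists (b * c); rewrite !rmorphM.
    + by exists b^-1; rewrite !fmorphV.
  - by exists (iota b).
  - by exists theta.
(* Equality of the constant fields enters here: a constant of [K(theta)] lies in [K], where the
   Euler derivation is zero. *)
have kD0 : kills_constants (adj base (j theta)) D0.
  move=> c /imE[e ->] e0; have [|b _ ->] := sameC (c := e).
    by apply: (fmorph_inj j); rewrite dj rmorph0.
  by rewrite D0E //; exists b.
have [D cD DE] := extend_tower extension_char0 cD0 kD0 F0j step gen.
exists D; split=> // [b|]; last by rewrite DE.
by rewrite DE ?D0E //; exists b.
Qed.

(** The terms are eigenvectors of [D] with distinct integer eigenvalues, and [D] acts on integrals
    because it commutes with [der]. *)
Lemma integral_terms (D : G -> G) : commuting (fun _ => True) D ->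
  (forall b, D (j (iota b)) = 0) -> D (j theta) = j theta ->
  forall s : seq int, uniq s -> forall a : int -> K,
  (exists g, der g = j (\sum_(k <- s) iota (a k) * theta ^ k)) ->
  forall k, k \in s -> exists g, der g = j (iota (a k) * theta ^ k).
Proof.
move=> cD D0 Dt; have sT := subfieldT G; have dD := comm_derivation cD.
have dG := der_derivation (fun _ : G => True).
have der_int (n : int) : der (n%:~R : G) = 0.
  have der_nat m : der (m%:R : G) = 0.
    elim: m => [|m IHm]; first exact: (drv0 sT dG).
    by rewrite -natr1 derD IHm (drv1 sT dG) addr0.
  by case: n => n; rewrite ?NegzE ?mulrNz ?(drvN sT dG) // -?pmulrn der_nat ?oppr0.
have tn : j theta != 0.
  rewrite fmorph_eq0; apply/eqP => t0; apply: trans_theta; exists 'X.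
    by rewrite polyX_eq0.
  by rewrite map_polyX rootX t0.
have Dterm b (k : int) : D (j (iota b * theta ^ k)) = k%:~R * j (iota b * theta ^ k).
  have -> : j (iota b * theta ^ k) = j (iota b) * j theta ^ k.
    by rewrite rmorphM fmorphXz.
  rewrite (drvM dD) // D0 mul0r add0r (drv_expz sT dD) // Dt.
  by rewrite mulfV // mulr1 mulrCA.
elim=> // l s IHs /andP[lNs us] a [g g'].
have [h h'] : exists h, der h = j (\sum_(k <- s) iota ((k - l)%:~R * a k) * theta ^ k).
  exists (D g - l%:~R * g).
  rewrite (drvB sT dG) // derM der_int mul0r add0r -(comm_der cD) // g'.
  rewrite !rmorph_sum /= (drv_sum sT dD) // !big_cons !Dterm mulrDr.
  rewrite opprD addrACA subrr add0r mulr_sumr -sumrB; apply: eq_bigr => k _.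
  by rewrite Dterm !rmorphM !rmorph_int intrB; ring.
(* Uniqueness keeps [l] out of [s], so the factor [k - l] is a nonzero constant and can be divided
   out of the integral. *)
have IH k : k \in s -> exists g, der g = j (iota (a k) * theta ^ k).
  move=> ks; have [g1 g1'] := IHs us _ (ex_intro _ h h') k ks.
  have kl : (k - l)%:~R != 0 :> G.
    apply: (intr_neq0 extension_char0); rewrite subr_eq0.
    by apply: contraNneq lNs => <-.
  exists ((k - l)%:~R^-1 * g1); rewrite derM (drvV sT dG) // der_int oppr0 !mul0r add0r g1'.
  by rewrite !rmorphM !rmorph_int -mulrA mulKf.
(* Subtracting the integrals of all other terms from [g] leaves one for the term of exponent [l]. *)
have [r r'] : exists r, der r = j (\sum_(k <- s) iota (a k) * theta ^ k).
  rewrite rmorph_sum /= big_seq.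
  elim/big_ind: _ => [|x y [rx <-] [ry <-]|k /IH //].
    by exists 0; exact: (drv0 sT dG).
  by exists (rx + ry); exact: derD.
move=> k; rewrite inE => /predU1P[->|]; last exact: IH.
exists (g - r); rewrite (drvB sT dG) // g' r' big_cons rmorphD.
by rewrite addrK.
Qed.

End ExponentialField.

(* E is the field K(theta); the sum over all integers j is finite because the
   support of a is contained in s. *)
Theorem theorem21
  (K : diffFieldType) (charK : [pchar K] =i pred0) (lK : l_closed K)
  (E : diffFieldType) (iota : {rmorphism K -> E})
  (diota : differential iota)
  (theta : E) (genE : forall x : E, adjoin iota [:: theta] x)
  (trans_theta : ~ algebraicOver iota theta)
  (eta : K) (dtheta : der theta = iota (der eta) * theta)
  (sameC : forall c : E, is_constant c -> exists2 b : K, is_constant b & c = iota b)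
  (a : int -> K) (s : seq int) (uniq_s : uniq s)
  (supp_a : forall j : int, j \notin s -> a j = 0)
  (f : E) (def_f : f = \sum_(j <- s) iota (a j) * theta ^ j) :
  (log_explicit K -> has_integral_in_gamma_ext f ->
   forall j : int, has_integral_in_gamma_ext (iota (a j) * theta ^ j))
  /\
  (has_integral_in_rational_gamma_ext f ->
   forall j : int,
     has_integral_in_rational_gamma_ext (iota (a j) * theta ^ j)).
Proof.
have ext (G : diffFieldType) (j : {rmorphism E -> G}) : gamma_ext j ->
    (exists g, der g = j f) -> forall k, exists g, der g = j (iota (a k) * theta ^ k).
  move=> [dj [t [step gen]]]; rewrite def_f => fg k.
  have [D [cD D0 Dt]] :=
    euler_derivation charK diota genE trans_theta dtheta sameC dj step gen.
  have [ks|/supp_a ->] := boolP (k \in s).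
    exact: (integral_terms charK trans_theta cD D0 Dt uniq_s).
  by exists 0; rewrite rmorph0 mul0r rmorph0 (drv0 (subfieldT G) (der_derivation _)).
(* The extension [G] is kept, so it stays rational in the second claim; there [ext] applies because
   a rational step is a gamma step. *)
split=> [_|] [G [j [ej fg]]] k; exists G, j; split=> //; first exact: ext.
apply: ext => //; case: ej => dj [t [step gen]].
by split=> //; exists t; split=> // i lti; left; exact: step.
Qed.
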